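(* Let $x_1,x_2,y_1,y_2,u_1,u_2,v_1,v_2,w_{\rm e},w_{\rm o},z_{\rm e},z_{\rm o},\lambda$ be commuting indeterminates and for $n\ge0$ let \[ \widehat{P}_n=\sum_{\sigma\in\mathfrak{D}_{2n}}x_1^{\mathrm{eareccpeak}}x_2^{\mathrm{eareccdfall}}y_1^{\mathrm{ereccval}}y_2^{\mathrm{ereccdrise}}u_1^{\mathrm{nrcpeak}}u_2^{\mathrm{nrcdfall}}v_1^{\mathrm{nrcval}}v_2^{\mathrm{nrcdrise}}w_{\rm e}^{\mathrm{evennrfix}}w_{\rm o}^{\mathrm{oddnrfix}}z_{\rm e}^{\mathrm{evenrar}}z_{\rm o}^{\mathrm{oddrar}}\lambda^{\mathrm{cyc}}, \] all statistics evaluated at $\sigma$. Then, with $v_1$ specialised to $y_1$, \[ \sum_{n\ge0}\widehat{P}_n\,t^n=\cfrac{1}{1-\delta_1t-\cfrac{\alpha_1t}{1-\delta_2t-\cfrac{\alpha_2t}{1-\delta_3 t-\cdots}}} \] as formal power series in $t$, where for $k\ge1$: $\alpha_{2k-1}=(\lambda+k-1)[x_1+(k-1)u_1]\,y_1$, $\alpha_{2k}=[x_2+(k-1)u_2+\lambda w_{\rm e}][y_2+(k-1)v_2+\lambda w_{\rm o}]$, and $\delta_1=\lambda^2z_{\rm e}z_{\rm o}$, $\delta_n=0$ for $n\ge2$.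
   Context: A D-permutation of $[2n]$ is a permutation $\sigma$ with $\sigma(2k-1)\ge 2k-1$ and $\sigma(2k)\le 2k$ for all $k$; $\mathfrak{D}_{2n}$ is the set of them ($\mathfrak{D}_0$ contains the empty permutation). For a permutation $\sigma$, an index $i$ is a cycle peak if $\sigma^{-1}(i)<i>\sigma(i)$, cycle valley if $\sigma^{-1}(i)>i<\sigma(i)$, cycle double rise if $\sigma^{-1}(i)<i<\sigma(i)$, cycle double fall if $\sigma^{-1}(i)>i>\sigma(i)$, fixed point if $\sigma(i)=i$. Index $i$ is a record if $\sigma(j)<\sigma(i)$ for all $j<i$, an antirecord if $\sigma(j)>\sigma(i)$ for all $j>i$; exclusive record = record not antirecord; exclusive antirecord = antirecord not record; record-antirecord = both; nr = neither. $\mathrm{eareccpeak},\mathrm{eareccdfall}$ count cycle peaks, cycle double falls that are exclusive antirecords; $\mathrm{ereccval},\mathrm{ereccdrise}$ count cycle valleys, cycle double rises that are exclusive records; $\mathrm{nrcpeak},\mathrm{nrcdfall},\mathrm{nrcval},\mathrm{nrcdrise}$ count cycle peaks, double falls, valleys, double rises that are neither records nor antirecords; $\mathrm{evennrfix}$ ($\mathrm{oddnrfix}$) counts even (odd) fixed points that are neither records nor antirecords; $\mathrm{evenrar}$ ($\mathrm{oddrar}$) counts even (odd) indices that are record-antirecords. $\mathrm{cyc}(\sigma)$ is the number of cycles (fixed points included). *)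

(* Defs.v *)
From mathcomp Require Import all_boot all_order all_algebra all_fingroup.

Set Implicit Arguments.
Unset Strict Implicit.
Unset Printing Implicit Defensive.

Import GRing.Theory.
Local Open Scope ring_scope.

(** * Permutation statistics *)

(* A permutation of [N] is an element of 'S_N.  The ordinal i : 'I_N stands
   for the index i + 1 of [N] = {1, ..., N}; order comparisons are unaffected
   by this shift, parities are not. *)
Definition odd_index N (i : 'I_N) : bool := odd i.+1.
Definition even_index N (i : 'I_N) : bool := ~~ odd i.+1.

Section Statistics.
Variables (N : nat) (s : 'S_N).
Implicit Types i j : 'I_N.

(* Used below for even N = 2 * n only. *)
Definition Dperm : bool :=
  [forall i, (odd_index i ==> (i <= s i)%N) && (even_index i ==> (s i <= i)%N)].

Definition cpeak i : bool := (((s^-1)%g i < i) && (s i < i))%N.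
Definition cval i : bool := ((i < (s^-1)%g i) && (i < s i))%N.
Definition cdrise i : bool := (((s^-1)%g i < i) && (i < s i))%N.
Definition cdfall i : bool := ((i < (s^-1)%g i) && (s i < i))%N.
Definition fixpt i : bool := s i == i.

Definition is_rec i : bool := [forall j : 'I_N, (j < i)%N ==> (s j < s i)%N].
Definition is_arec i : bool := [forall j : 'I_N, (i < j)%N ==> (s i < s j)%N].
Definition is_erec i : bool := is_rec i && ~~ is_arec i.
Definition is_earec i : bool := is_arec i && ~~ is_rec i.
Definition is_rar i : bool := is_rec i && is_arec i.
Definition is_nrar i : bool := ~~ is_rec i && ~~ is_arec i.

Definition eareccpeak : nat := #|[set i | cpeak i & is_earec i]|.
Definition eareccdfall : nat := #|[set i | cdfall i & is_earec i]|.
Definition ereccval : nat := #|[set i | cval i & is_erec i]|.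
Definition ereccdrise : nat := #|[set i | cdrise i & is_erec i]|.
Definition nrcpeak : nat := #|[set i | cpeak i & is_nrar i]|.
Definition nrcdfall : nat := #|[set i | cdfall i & is_nrar i]|.
Definition nrcval : nat := #|[set i | cval i & is_nrar i]|.
Definition nrcdrise : nat := #|[set i | cdrise i & is_nrar i]|.
Definition evennrfix : nat := #|[set i | [&& even_index i, fixpt i & is_nrar i]]|.
Definition oddnrfix : nat := #|[set i | [&& odd_index i, fixpt i & is_nrar i]]|.
Definition evenrar : nat := #|[set i | even_index i & is_rar i]|.
Definition oddrar : nat := #|[set i | odd_index i & is_rar i]|.

(* porbits also contains the singleton orbits of the fixed points. *)
Definition cyc : nat := #|porbits s|.

End Statistics.

Definition Phat (R : comNzRingType)
    (x1 x2 y1 y2 u1 u2 v1 v2 we wo ze zo lambda : R) (n : nat) : R :=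
  \sum_(s : 'S_(2 * n) | Dperm s)
    (x1 ^+ eareccpeak s * x2 ^+ eareccdfall s *
     y1 ^+ ereccval s * y2 ^+ ereccdrise s *
     u1 ^+ nrcpeak s * u2 ^+ nrcdfall s *
     v1 ^+ nrcval s * v2 ^+ nrcdrise s *
     we ^+ evennrfix s * wo ^+ oddnrfix s *
     ze ^+ evenrar s * zo ^+ oddrar s * lambda ^+ cyc s).

(** * Formal power series and continued fractions *)

Section Series.
Variable R : comNzRingType.

(* The series \sum_n f_n t^n is its coefficient sequence f. *)
Definition fps : Type := nat -> R.

Definition fps_one : fps := fun n => (n == 0)%:R.
Definition fps_mul (f g : fps) : fps := fun n => \sum_(i < n.+1) f i * g (n - i)%N.

(* The first n coefficients of 1 / f, assuming f has constant term 1: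
   comparing coefficients in f * g = 1 gives
   g_m = [m = 0] - \sum_(i < m) f_(m - i) g_i. *)
Fixpoint fps_inv_seq (f : fps) (n : nat) : seq R :=
  if n is m.+1 then
    let g := fps_inv_seq f m in
    rcons g ((m == 0)%:R - \sum_(i < m) f (m - i)%N * g`_i)
  else [::].
Definition fps_inv (f : fps) : fps := fun n => (fps_inv_seq f n.+1)`_n.

Lemma size_fps_inv_seq f n : size (fps_inv_seq f n) = n.
Proof. by elim: n => //= n IHn; rewrite size_rcons IHn. Qed.

Lemma nth_fps_inv_seq f n i : (i < n)%N -> (fps_inv_seq f n)`_i = fps_inv f i.
Proof.
elim: n => // n IHn; rewrite ltnS leq_eqVlt => /predU1P[-> // | lt_in].
by rewrite /= nth_rcons size_fps_inv_seq lt_in IHn.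
Qed.

Lemma fps_mulV f : f 0%N = 1 -> fps_mul f (fps_inv f) =1 fps_one.
Proof.
move=> f0 n; rewrite /fps_mul big_ord_recl f0 mul1r subn0 {1}/fps_inv /=.
rewrite nth_rcons size_fps_inv_seq ltnn eqxx.
suff -> : \sum_(i < n) f (bump 0 i) * fps_inv f (n - bump 0 i)%N
        = \sum_(i < n) f (n - i)%N * (fps_inv_seq f n)`_i by rewrite subrK.
rewrite (reindex_inj rev_ord_inj); apply: eq_bigr => i _.
rewrite nth_fps_inv_seq //= /bump /= add1n subnSK // subKn //.
exact: ltnW.
Qed.

(* The series 1 - d t - a t S. *)
Definition cf_den (d a : R) (S : fps) : fps :=
  fun n => if n is m.+1 then - (d * (m == 0)%:R) - a * S m else 1.

(* cf_conv delta alpha n k is the finite continued fraction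
   1 / (1 - delta_k t - alpha_k t / (1 - delta_(k+1) t - ...))
   with n denominators, the last one being 1 - delta_(k+n-1) t. *)
Fixpoint cf_conv (delta alpha : nat -> R) (n k : nat) : fps :=
  if n is m.+1 then
    fps_inv (cf_den (delta k) (alpha k) (cf_conv delta alpha m k.+1))
  else fun=> 0.

(* F is the infinite continued fraction
   1 / (1 - delta_1 t - alpha_1 t / (1 - delta_2 t - ...)):
   its convergents tend to F in the t-adic topology, i.e. every coefficient is
   eventually constant, with the value prescribed by F.
   The values delta 0 and alpha 0 are not used. *)
Definition is_Tfraction (F : fps) (delta alpha : nat -> R) : Prop :=
  forall m : nat, exists N : nat, forall n : nat, (N <= n)%N ->
    cf_conv delta alpha n 1 m = F m.

End Series.

(* Main.v *)
(* A permutation is cut into its step types: each index is a fixed point or is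
   described by the directions in which its image and its preimage lie.  The
   number [h] of arcs passing over a point is the height of a lattice path
   determined by the step types.  Among the D-permutations with given step
   types, choose first the images of the indices moved down, from left to right,
   and then the images of the indices moved up, from right to left.  At each
   index the number of available images depends on [h] only, exactly one of them
   makes the index an (anti)record, and at a cycle valley, exactly one of them
   closes a cycle, of which the valley is then the minimum.  Hence the sum over
   the class is a product of local weights (merging [v1] with [y1] lets the
   cycles be counted at the valleys), and the generating polynomial is a sum over
   weighted paths, which is compared with the continued fraction by means of the
   products of its tails. *)

Require Import Defs.
From mathcomp Require Import all_boot all_order all_algebra all_fingroup.
From mathcomp Require Import zify ring.

Set Implicit Arguments.
Unset Strict Implicit.
Unset Printing Implicit Defensive.

Import GRing.Theory.
Local Open Scope ring_scope.

(** * Convergents of the continued fraction *)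

Section SeriesTheory.
Variable R : comNzRingType.
Implicit Types f g h : fps R.

(** Truncating to polynomials lets associativity of [fps_mul] be inherited from polynomial
    multiplication. *)
Lemma fps_mul_poly f g N n : (n < N)%N ->
  fps_mul f g n = ((\poly_(i < N) f i) * (\poly_(i < N) g i))`_n.
Proof.
move=> ltnN; rewrite coefM; apply: eq_bigr => i _.
have lti := ltn_ord i.
have [ltiN ltniN] : (i < N /\ n - i < N)%N by lia.
by rewrite !coef_poly ltiN ltniN.
Qed.

Lemma fps_mulA f g h : fps_mul f (fps_mul g h) =1 fps_mul (fps_mul f g) h.
Proof.
move=> n; pose p k := \poly_(i < n.+1) (k i : R).
have mulE (a b : fps R) i : (i < n.+1)%N -> fps_mul a b i = (p a * p b)`_i.
  exact: fps_mul_poly.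
have -> : fps_mul f (fps_mul g h) n = (p f * (p g * p h))`_n.
  rewrite coefM; apply: eq_bigr => i _.
  by rewrite -mulE ?ltnS ?leq_subr // coef_poly ltn_ord.
rewrite mulrA coefM; apply: eq_bigr => i _.
by rewrite mulE // coef_poly ltnS leq_subr.
Qed.

(** The denominator multiplied out: [f = 1 + delta_k t f + alpha_k t S f]. *)
Lemma cf_convE delta alpha N k (f := cf_conv delta alpha N.+1 k)
    (S := cf_conv delta alpha N k.+1 : fps R) n :
  f n = (n == 0)%:R +
    (if n is m.+1 then delta k * f m + alpha k * fps_mul S f m else 0).
Proof.
have /(_ n) : fps_mul (cf_den (delta k) (alpha k) S) f =1 fps_one R.
  exact: fps_mulV.
rewrite {1}/fps_mul /fps_one big_ord_recl subn0 mul1r.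
case: n => [|m] /=; first by rewrite big_ord0 addr0 => ->; rewrite addr0.
rewrite add0r => /eqP; rewrite addr_eq0 => /eqP ->.
rewrite -sumrN (eq_bigr (fun i : 'I_m.+1 => delta k * ((i == 0 :> nat)%:R * f (m - i)%N)
   + alpha k * (S i * f (m - i)%N))); last first.
  by move=> i _; rewrite /bump /= add1n subSS; ring.
rewrite big_split /= -!mulr_sumr; congr (_ * _ + _).
by rewrite big_ord_recl /= mul1r subn0 big1 ?addr0 // => i _; rewrite mul0r.
Qed.

(* The product of the first [k] tails of the [N]-th convergent. *)
Fixpoint tail_prod (delta alpha : nat -> R) N k : fps R :=
  if k is k'.+1
  then fps_mul (cf_conv delta alpha (N - k') k) (tail_prod delta alpha N k')
  else fps_one R.

Lemma fps_mul1 f : fps_mul f (fps_one R) =1 f.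
Proof.
move=> n; rewrite /fps_mul big_ord_recr /= subnn mulr1 big1 ?add0r // => i _.
by rewrite /fps_one subn_eq0 leqNgt ltn_ord mulr0.
Qed.

(* Multiplying out the denominators makes the recursion linear. *)
Lemma tail_prod_rec delta alpha N k n (g := tail_prod delta alpha N) : (k < N)%N ->
  g k.+1 n = g k n + (if n is m.+1 then
     delta k.+1 * g k.+1 m + alpha k.+1 * g k.+2 m else 0).
Proof.
move=> ltkN; rewrite {1}/g /= -/(g k).
have [M defM]: exists M, (N - k)%N = M.+1 by exists (N - k).-1; lia.
have defM1 : (N - k.+1)%N = M by lia.
set f := cf_conv _ _ _ _.
have fE i : f i = (i == 0)%:R + (if i is m.+1 then delta k.+1 * f m + alpha k.+1
   * fps_mul (cf_conv delta alpha M k.+2) f m else 0).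
  by rewrite /f defM cf_convE.
case: n => [|m].
  by rewrite /fps_mul big_ord_recl big_ord0 fE !addr0 mul1r.
rewrite /fps_mul big_ord_recl fE subn0 addr0 mul1r; congr (_ + _).
have -> : g k.+1 m = fps_mul f (g k) m by [].
have -> : g k.+2 m = fps_mul (fps_mul (cf_conv delta alpha M k.+2) f) (g k) m.
  by rewrite -fps_mulA /g /= defM1.
rewrite /fps_mul !mulr_sumr -big_split /=; apply: eq_bigr => i _.
by rewrite fE /= /bump /= add0n subSS -/(fps_mul _ f i); ring.
Qed.

End SeriesTheory.
(** * Weighted paths *)

(* [None] is a fixed point; [Some (u, d)] says whether the index is moved up
   ([u]) and whether its preimage lies below it ([d]): [(true, false)] is a
   cycle valley, [(false, true)] a cycle peak, [(true, true)] a cycle double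
   rise and [(false, false)] a cycle double fall. *)
Notation step_type := (option (bool * bool)) (only parsing).

(* Here and below [o] tells whether the current index, counted from 1, is odd. *)
Definition step_ok (o : bool) (h : nat) (t : step_type) : bool :=
  if t is Some (u, d) then (u == o) && (u && ~~ d || (0 < h)%N) else true.

Definition next_height (h : nat) (t : step_type) : nat :=
  match t with
  | Some (true, false) => h.+1
  | Some (false, true) => h.-1
  | _ => h
  end.

Fixpoint valid_path (o : bool) (h : nat) (l : seq step_type) : bool :=
  if l is t :: l' then step_ok o h t && valid_path (~~ o) (next_height h t) l'
  else h == 0.

Definition height_at (l : seq step_type) (i : nat) : nat :=
  foldl next_height 0 (take i l).

Section Paths.
Variables (R : comNzRingType) (x1 x2 y1 y2 u1 u2 v2 we wo ze zo lambda : R).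

(** Of the [h] available images one yields a record or antirecord and [h - 1] do not. A valley has
    [h + 1] choices, one of which closes a cycle. *)
Definition step_wt (o : bool) (h : nat) (t : step_type) : R :=
  match t with
  | None => lambda * (if o then (if h == 0 then zo else wo)
                      else (if h == 0 then ze else we))
  | Some (true, false) => (lambda + h%:R) * y1
  | Some (true, true) => y2 + (h%:R - 1) * v2
  | Some (false, true) => x1 + (h%:R - 1) * u1
  | Some (false, false) => x2 + (h%:R - 1) * u2
  end.

Fixpoint path_wt (o : bool) (h : nat) (l : seq step_type) : R :=
  if l is t :: l' then
    if step_ok o h t then step_wt o h t * path_wt (~~ o) (next_height h t) l'
    else 0
  else (h == 0)%:R.

Lemma path_wtE o h l : path_wt o h l =
  if valid_path o h l then
    \prod_(i < size l) step_wt (o (+) odd i) (foldl next_height h (take i l)) (nth None l i)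
  else 0.
Proof.
elim: l o h => [|t l IHl] o h /=; first by rewrite big_ord0; case: eqP.
case: step_ok => //=; rewrite IHl; case: valid_path; last by rewrite mulr0.
rewrite big_ord_recl /= addbF; congr (_ * _); apply: eq_bigr => i _.
by rewrite /bump /= add0n; case: (odd i); case: o.
Qed.

Definition path_sum n o h : R := \sum_(l : n.-tuple step_type) path_wt o h l.

Lemma path_sum0 o h : path_sum 0 o h = (h == 0)%:R.
Proof.
rewrite /path_sum (bigD1 [tuple]) //= big1 ?addr0 // => l.
by rewrite [l]tuple0 => /eqP.
Qed.

Lemma sum_step_type (F : step_type -> R) : \sum_t F t =
  F None + F (Some (true, true)) + F (Some (true, false))
  + F (Some (false, true)) + F (Some (false, false)).
Proof.
rewrite (bigD1 None) //= (bigD1 (Some (true, true))) //=.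
rewrite (bigD1 (Some (true, false))) //= (bigD1 (Some (false, true))) //=.
rewrite (bigD1 (Some (false, false))) //= big1 ?addr0 ?addrA //.
by case=> [[[] []]|].
Qed.

Lemma path_sumS n o h : path_sum n.+1 o h =
  \sum_t if step_ok o h t then step_wt o h t * path_sum n (~~ o) (next_height h t)
         else 0.
Proof.
rewrite /path_sum.
rewrite (reindex (fun p : step_type * n.-tuple step_type => cons_tuple p.1 p.2)) /=.
  rewrite -(pair_bigA _ (fun t (l : n.-tuple step_type) => path_wt o h (t :: l))) /=.
  apply: eq_bigr => t _; case: step_ok; last by rewrite big1.
  by rewrite mulr_sumr.
exists (fun l => (thead l, behead_tuple l)) => [[t l] _|l _] /=.
  by rewrite theadE; congr (_, _); apply: val_inj.
by case/tupleP: l => t l; apply: val_inj; rewrite /= theadE.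
Qed.

(* Level steps at an odd, resp. even, index and height [h]. *)
Definition odd_level h : R :=
  if h is h'.+1 then y2 + h'%:R * v2 + lambda * wo else lambda * zo.
Definition even_level h : R :=
  if h is h'.+1 then x2 + h'%:R * u2 + lambda * we else lambda * ze.

Lemma path_sum_odd n h : path_sum n.+1 true h =
  odd_level h * path_sum n false h + (lambda + h%:R) * y1 * path_sum n false h.+1.
Proof.
rewrite path_sumS sum_step_type /=.
by case: h => [|h] /=; rewrite -?[h.+1%:R]natr1; ring.
Qed.

Lemma path_sum_even n h : path_sum n.+1 false h =
  even_level h * path_sum n true h +
  (if h is h'.+1 then (x1 + h'%:R * u1) * path_sum n true h' else 0).
Proof.
rewrite path_sumS sum_step_type /=.
by case: h => [|h] /=; rewrite -?[h.+1%:R]natr1; ring.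
Qed.

(** * Path sums as coefficients of products of tails *)

Section Fraction.
Variables alpha delta : nat -> R.
Hypothesis alpha_odd : forall k : nat, (1 <= k)%N ->
  alpha (2 * k - 1)%N = (lambda + k%:R - 1) * (x1 + (k%:R - 1) * u1) * y1.
Hypothesis alpha_even : forall k : nat, (1 <= k)%N ->
  alpha (2 * k)%N = (x2 + (k%:R - 1) * u2 + lambda * we)
                    * (y2 + (k%:R - 1) * v2 + lambda * wo).
Hypothesis delta_1 : delta 1%N = lambda ^+ 2 * ze * zo.
Hypothesis delta_ge2 : forall n : nat, (2 <= n)%N -> delta n = 0.

(** The total weight of the quickest descents from height [h], starting at an odd index: peaks occur
    at even indices only, so each is preceded by a level step. *)
Let scale h : R := \prod_(j < h) ((x1 + j%:R * u1) * odd_level j.+1).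

Lemma alphaS2 h : alpha h.*2.+1 = (lambda + h%:R) * (x1 + h%:R * u1) * y1.
Proof.
have -> : h.*2.+1 = (2 * h.+1 - 1)%N by lia.
by rewrite alpha_odd // -natr1; ring.
Qed.

Lemma alpha2 h : alpha h.+1.*2 = even_level h.+1 * odd_level h.+1.
Proof. by rewrite -mul2n alpha_even // -natr1 /= !addrK. Qed.

(* Up to the weights of its [h] compulsory descents, the paths of length [2 n]
   starting at height [h] are counted by the coefficient of [t ^ (n - h)] in
   the product of the first [2 h + 1] tails of the continued fraction. *)
Lemma path_sum_tail_prod N n : let g := tail_prod delta alpha N in
  (forall h, (h + n < N)%N -> path_sum n.*2 true h =
     if (h <= n)%N then scale h * g h.*2.+1 (n - h)%N else 0) /\
  (forall h, (h + n < N)%N -> path_sum n.*2.+1 false h =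
     if (h <= n.+1)%N then
       (if h is h'.+1 then scale h' * (x1 + h'%:R * u1) * g h.*2 (n - h')%N
        else even_level 0 * g 1 n)
     else 0).
Proof.
move=> g.
have gS k m : (k < N)%N -> g k.+1 m = g k m + (if m is m'.+1 then
     delta k.+1 * g k.+1 m' + alpha k.+1 * g k.+2 m' else 0).
  exact: tail_prod_rec.
have scaleS h : scale h.+1 = scale h * ((x1 + h%:R * u1) * odd_level h.+1).
  by rewrite /scale big_ord_recr.
have scale0 : scale 0 = 1 by rewrite /scale big_ord0.
(* Prepending one even step deduces the second claim from the first, so the induction can run on the
   first alone. *)
have odd_even n' : (forall h, (h + n' < N)%N -> path_sum n'.*2 true h =
     if (h <= n')%N then scale h * g h.*2.+1 (n' - h)%N else 0) ->
  (forall h, (h + n' < N)%N -> path_sum n'.*2.+1 false h =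
     if (h <= n'.+1)%N then
       (if h is h'.+1 then scale h' * (x1 + h'%:R * u1) * g h.*2 (n' - h')%N
        else even_level 0 * g 1 n')
     else 0).
  move=> IHo h lthN; rewrite path_sum_even IHo //.
  case: h lthN => [|h] lthN; first by rewrite scale0 subn0 /=; ring.
  rewrite IHo; last by lia.
  rewrite ltnS doubleS scaleS; case: (leqP h n') => [lehn|ltnh]; last first.
    by rewrite leqNgt ltnS (ltnW ltnh) /= !mulr0 addr0.
  rewrite (gS h.*2.+1); last by lia.
  have -> : delta h.*2.+2 = 0 by apply: delta_ge2.
  case: (ltnP h n') => [lthn|lenh].
    have -> : (n' - h = (n' - h.+1).+1)%N by lia.
    (* The factor [odd_level h.+1] of [scale h.+1] completes [even_level h.+1] to [alpha]. *)
    by rewrite -doubleS alpha2 /=; ring.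
  have -> : (n' - h = 0)%N by lia.
  by ring.
suff path_odd h : (h + n < N)%N -> path_sum n.*2 true h =
    if (h <= n)%N then scale h * g h.*2.+1 (n - h)%N else 0.
  by split; [exact: path_odd | exact/odd_even/path_odd].
elim: n h => [|n IHn] h lthN.
  rewrite path_sum0; case: h lthN => [|h] //= lthN.
  by rewrite scale0 gS //= addr0 mul1r.
rewrite doubleS path_sum_odd !(odd_even n IHn) //; try by lia.
rewrite !ltnS; case: (ltngtP h n.+1) => [lehn|ltnh|eqh].
- have -> : (h <= n)%N by lia.
  have -> : (n.+1 - h = (n - h).+1)%N by lia.
  rewrite gS ?alphaS2 ?doubleS; last by lia.
  case: h lthN lehn => [|h] lthN lehn.
    (* The empty product has no term of positive degree; two consecutive fixed points at height 0
       give [delta 1]. *)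
    have g0 : g 0 n.+1 = 0 by [].
    by rewrite scale0 delta_1 subn0 double0 g0 /=; ring.
  rewrite delta_ge2 // scaleS.
  have -> : (n - h = (n - h.+1).+1)%N by lia.
  by ring.
- have -> : (h <= n)%N = false by lia.
  by rewrite !mulr0 addr0.
- rewrite eqh in lthN *; rewrite ltnn subnn gS ?scaleS ?subnn; last by lia.
  by rewrite addr0; ring.
Qed.

Lemma path_sum_Tfraction : is_Tfraction (fun n => path_sum n.*2 true 0) delta alpha.
Proof.
move=> m; exists m.+1 => n ltmn; have [path_odd _] := path_sum_tail_prod n m.
rewrite path_odd ?add0n // subn0 /scale big_ord0 mul1r /=.
by rewrite fps_mul1 subn0.
Qed.

End Fraction.
End Paths.

(** * Step types and heights of a permutation *)

(* Reversing the order exchanges the indices moved up with those moved down, and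
   records with antirecords; [before b] allows both to be treated at once. *)
Definition before (b : bool) (i j : nat) : bool := if b then (i < j)%N else (j < i)%N.

Lemma before_neg N b (i j : 'I_N) : i != j -> ~~ before b i j -> before b j i.
Proof. by rewrite -val_eqE; case: b => /=; lia. Qed.

Lemma before_trans b j i k : before b i j -> before b j k -> before b i k.
Proof. by case: b => /=; lia. Qed.

Lemma before_irr b i : before b i i = false.
Proof. by case: b => /=; lia. Qed.

Section PermTypes.
Variable N : nat.
Implicit Types (s t : 'S_N) (i j k : 'I_N).

Definition index_type s i : step_type :=
  if s i == i then None else Some ((i < s i)%N, ((s^-1)%g i < i)%N).

Definition height s m : nat := #|[set k : 'I_N | (k < m <= s k)%N]|.

Lemma eq_permV s k i : (k == (s^-1)%g i) = (s k == i).
Proof. by rewrite -{2}[i](permKV s) (inj_eq (@perm_inj _ s)). Qed.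

Lemma permV_fix s i : ((s^-1)%g i == i) = (s i == i).
Proof. by rewrite eq_sym eq_permV. Qed.

(** Between the gaps before and after [i], only the arcs leaving and entering [i] can change status.
    The additive form avoids truncated subtraction. *)
Lemma heightS s i :
  (height s i.+1 + ((s^-1)%g i < i) = height s i + (i < s i))%N.
Proof.
rewrite /height (cardsD1 ((s^-1)%g i) [set k : 'I_N | (k < i <= s k)%N]).
rewrite (cardsD1 i [set k : 'I_N | (k < i.+1 <= s k)%N]) !inE permKV.
have -> : [set k : 'I_N | (k < i.+1 <= s k)%N] :\ i
        = [set k : 'I_N | (k < i <= s k)%N] :\ (s^-1)%g i.
  apply/setP => k; rewrite !inE eq_permV -!val_eqE /=.
  by lia.
rewrite ltnS !leqnn andbT /=; set c := #|_|; clearbody c.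
by lia.
Qed.

(** As many indices as images lie below [m], so equally many arcs cross the gap in either
    direction. *)
Lemma height_sym s m : #|[set k : 'I_N | (s k < m <= k)%N]| = height s m.
Proof.
pose A := [set k : 'I_N | (k < m)%N]; pose B := [set k : 'I_N | (s k < m)%N].
have eqAB : #|B| = #|A|.
  have -> : B = s @^-1: A by apply/setP => k; rewrite !inE.
  by rewrite card_preimset //; exact: perm_inj.
have := cardsID B A; have := cardsID A B; rewrite setIC eqAB => <-.
move=> /eqP; rewrite eqn_add2l => /eqP eqD; rewrite /height.
rewrite (_ : [set k : 'I_N | (k < m <= s k)%N] = A :\: B).
  by rewrite eqD; apply: eq_card => k; rewrite !inE -leqNgt andbC.
by apply/setP => k; rewrite !inE -leqNgt andbC.
Qed.

Lemma height0 s : height s 0 = 0.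
Proof. by apply: eq_card0 => k; rewrite !inE. Qed.

Lemma heightN s : height s N = 0.
Proof. by apply: eq_card0 => k; rewrite !inE; have := ltn_ord (s k); lia. Qed.

Lemma height_next s i : height s i.+1 = next_height (height s i) (index_type s i).
Proof.
have := heightS s i; rewrite /index_type; case: (eqVneq (s i) i) => [si|_].
  have /eqP -> : (s^-1)%g i == i by rewrite permV_fix si.
  by rewrite si ltnn !addn0.
by do 2![case: ltnP => _ /=]; lia.
Qed.

Lemma height_at_perm s m : (m <= N)%N ->
  height s m = height_at [seq index_type s i | i <- enum 'I_N] m.
Proof.
elim: m => [|m IHm] ltmN; first by rewrite height0 /height_at take0.
have := height_next s (Ordinal ltmN); rewrite [nat_of_ord _]/= => ->.
rewrite IHm ?(ltnW ltmN) // /height_at.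
set l := [seq _ | _ <- _].
have ltm : (m < size (enum 'I_N))%N by rewrite size_enum_ord.
have ltml : (m < size l)%N by rewrite size_map.
rewrite (take_nth None ltml) foldl_rcons (nth_map (Ordinal ltmN) None _ ltm).
by congr (next_height _ (index_type s _)); apply: val_inj; rewrite /= nth_enum_ord.
Qed.

Lemma fix_rec s i : s i = i -> is_rec s i = (height s i == 0).
Proof.
move=> si; rewrite cards_eq0; apply/forallP/eqP => [rec_i|h0].
  apply/setP => k; rewrite !inE; have := rec_i k; rewrite si; lia.
move=> k; have /setP/(_ k) := h0; rewrite !inE si; lia.
Qed.

(** By [height_sym] the condition is the one in [fix_rec]: a fixed point is both a record and an
    antirecord, or neither. *)
Lemma fix_arec s i : s i = i -> is_arec s i = (height s i == 0).
Proof.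
move=> si; rewrite -height_sym cards_eq0; apply/forallP/eqP => [rec_i|h0].
  apply/setP => k; rewrite !inE; have := rec_i k; rewrite si.
  have [->|neqk] := eqVneq k i; first by rewrite si ltnn.
  by move: neqk; rewrite -val_eqE /=; lia.
move=> k; have /setP/(_ k) := h0; rewrite !inE si.
have [ski|neqk] := eqVneq (s k) i; last by move: neqk; rewrite -val_eqE /=; lia.
have -> : k = i by apply: (@perm_inj _ s); rewrite si.
by rewrite ltnn.
Qed.

(** The arc up from [i] forces an arc down across the gap after [i]; its source lies after [i] and
    its image below [s i]. *)
Lemma exc_not_arec s i : (i < s i)%N -> is_arec s i = false.
Proof.
move=> lti; have : (0 < height s i.+1)%N.
  by rewrite card_gt0; apply/set0Pn; exists i; rewrite inE ltnSn.
rewrite -height_sym card_gt0 => /set0Pn[k]; rewrite inE => /andP[ltk ltik].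
by apply/negbTE/forallPn; exists k; rewrite negb_imply ltik -leqNgt; lia.
Qed.

Lemma aexc_not_rec s i : (s i < i)%N -> is_rec s i = false.
Proof.
move=> lti; have : (0 < height s i)%N.
  by rewrite -height_sym card_gt0; apply/set0Pn; exists i; rewrite inE lti leqnn.
rewrite card_gt0 => /set0Pn[k]; rewrite inE => /andP[ltk leik].
by apply/negbTE/forallPn; exists k; rewrite negb_imply ltk -leqNgt; lia.
Qed.

(** * Exchanging images *)

(* The positions of the images available to [i], once the indices moved in
   direction [b] that come after [i] for [before b] have received theirs. *)
Definition choices b s i : {set 'I_N} :=
  [set k : 'I_N | ~~ before b i k && before b i (s k)].

(** The arc of [i] itself crosses the gap after [i] if it goes up, the gap before [i] if it goes
    down. *)
Lemma card_choices b s i :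
  #|choices b s i| = height s (if b then i.+1 else i).
Proof.
case: b; last rewrite -height_sym; apply: eq_card => k; rewrite !inE /=; lia.
Qed.

(** Composition is from left to right, so the images of [i] and [k] are exchanged. *)
Definition swap s i k : 'S_N := (tperm i k * s)%g.

Lemma swapE s i k j : swap s i k j = s (tperm i k j).
Proof. by rewrite permM. Qed.

Lemma swapVE s i k j : ((swap s i k)^-1)%g j = tperm i k ((s^-1)%g j).
Proof. by rewrite /swap invMg tpermV permM. Qed.

Definition same_type s t : Prop := forall i, index_type s i = index_type t i.

Lemma index_type_before s t : same_type s t ->
  (forall b i, before b i (s i) = before b i (t i)) /\
  (forall b i, before b ((s^-1)%g i) i = before b ((t^-1)%g i) i).
Proof.
move=> eq_st; suff H i : [/\ (i < s i) = (i < t i), (s i < i) = (t i < i),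
    (((s^-1)%g i) < i) = (((t^-1)%g i) < i) & (i < (s^-1)%g i) = (i < (t^-1)%g i)]%N.
  by split=> -[] i; case: (H i).
have := eq_st i; rewrite /index_type -!val_eqE /=.
have := permV_fix s i; have := permV_fix t i; rewrite -!val_eqE /= => fixs fixt.
case: ifP => fix1; case: ifP => fix2 //.
  by move=> _; split; lia.
by case=> eq1 eq2; split; lia.
Qed.

Lemma same_typeP s t :
  (forall i, (i < s i)%N = (i < t i)%N) -> (forall i, (s i < i)%N = (t i < i)%N) ->
  (forall i, ((s^-1)%g i < i)%N = ((t^-1)%g i < i)%N) -> same_type s t.
Proof.
move=> eq1 eq2 eq3 i; rewrite /index_type eq1 eq3.
have -> // : (s i == i) = (t i == i).
by rewrite -!val_eqE /= !eqn_leq !(leqNgt (s i)) !(leqNgt (t i)) !(leqNgt i) eq1 eq2.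
Qed.

(** In direction [b], both [i] and [k] come before both [s i] and [s k], so the exchange alters no
    direction. *)
Lemma swap_same_type b s i k : before b i (s i) -> k \in choices b s i ->
  same_type (swap s i k) s.
Proof.
rewrite inE => lti /andP[leki ltk].
have ltk' : before b k (s k).
  by case: b lti leki ltk => /= ? ? ?; lia.
have ltki : before b k (s i).
  by case: b lti leki ltk {ltk'} => /= ? ? ?; lia.
apply: same_typeP => j; rewrite ?swapE ?swapVE.
- by case: tpermP => [->|->|//]; move: lti leki ltk ltk' ltki; case: b => /=; lia.
- by case: tpermP => [->|->|//]; move: lti leki ltk ltk' ltki; case: b => /=; lia.
- case: tpermP => [/eqP|/eqP|//]; rewrite eq_sym eq_permV => /eqP <-; rewrite permK;
  by move: lti leki ltk ltk' ltki; case: b => /=; lia.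
Qed.

(* [is_rec] for [b = true] and [is_arec] for [b = false], up to conversion. *)
Definition brec b s i : bool := [forall j : 'I_N, before b j i ==> before b (s j) (s i)].

Lemma choices_id b s i : before b i (s i) -> i \in choices b s i.
Proof. by rewrite inE before_irr. Qed.

(** The extreme available image makes [i] a (anti)record; any other choice leaves that image at an
    index before [i]. *)
Lemma brec_swap b s i : before b i (s i) ->
  exists2 k0, k0 \in choices b s i &
    {in choices b s i, forall k, brec b (swap s i k) i = (k == k0)}.
Proof.
move=> lti; have Ki := choices_id lti.
(* Reflecting the values lets a maximum serve both directions. *)
pose f k := if b then (s k : nat) else (N - s k)%N.
pose k0 := [arg max_(k > i in choices b s i) f k].
have [Kk0 maxk0]: k0 \in choices b s i /\
    {in choices b s i, forall k, k != k0 -> before b (s k) (s k0)}.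
  rewrite /k0; case: arg_maxnP => // k Kk maxk; split=> // j Kj neqjk.
  have := maxk j Kj; rewrite /f.
  have : s j != s k by rewrite (inj_eq perm_inj).
  rewrite -val_eqE /=; have := ltn_ord (s j); have := ltn_ord (s k).
  by clear; case: b => /=; lia.
exists k0 => // k Kk; apply/idP/eqP => [/forallP rec_k|->].
  apply/eqP/negPn/negP => neqk.
  have: before b (tperm i k k0) i.
    case: tpermP => [eqk0|eqk0|/eqP nk0i _].
    - by apply: before_neg; [rewrite eq_sym -eqk0 | case/setIdP: Kk].
    - by rewrite eqk0 eqxx in neqk.
    by apply: before_neg; [rewrite eq_sym | case/setIdP: Kk0].
  move/(implyP (rec_k _)); rewrite !swapE tpermK tpermL => lt1.
  by have := before_trans lt1 (maxk0 _ Kk neqk); rewrite before_irr.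
apply/forallP => j; apply/implyP => ltji; rewrite !swapE tpermL.
case: tpermP => [eqj|eqj|/eqP nji /eqP njk0].
- by rewrite eqj before_irr in ltji.
- apply: maxk0 => //; apply: contraTneq ltji => eqi.
  by rewrite eqj -eqi before_irr.
case: (boolP (before b i (s j))) => [ltij|leji].
  apply: maxk0 => //; rewrite inE ltij andbT.
  by move: ltji; clear; case: b => /=; lia.
have /setIdP[_] := Kk0; move: leji (s k0) => + v; clear.
by case: b => /=; lia.
Qed.

(** If [j] before [i] had its [t]-image beyond that of [i], the [s]-preimage of [t j] would be moved
    in direction [b] and, [i] being a record of [s], come after [i]. There [s] and [t] agree, so it
    would be [j]. *)
Lemma brec_revealed b s t i : same_type s t -> before b i (s i) -> s i = t i ->
  (forall j, before b i j -> before b j (s j) -> s j = t j) ->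
  brec b s i -> brec b t i.
Proof.
move=> eq_st lti eqi eq_after /forallP rec_s.
have [eq_out eq_in] := index_type_before eq_st.
apply/forallP => j; apply/implyP => ltji; rewrite -eqi.
apply/negPn/negP => nlt; pose k := (s^-1)%g (t j).
have sk : s k = t j by rewrite permKV.
have neqij : s i != t j.
  by rewrite eqi (inj_eq perm_inj); apply: contraTneq ltji => ->; rewrite before_irr.
have lt_si : before b (s i) (t j) by apply: before_neg nlt; rewrite eq_sym.
have ltk : before b k (s k).
  have := eq_in b (t j); rewrite permK => eqk; rewrite sk /k eqk.
  exact: before_trans ltji (before_trans lti lt_si).
have nltki : ~~ before b k i.
  apply/negP => /(implyP (rec_s k)); rewrite sk => lt2.
  by have := before_trans lt2 lt_si; rewrite before_irr.
have [eqki|neqki] := eqVneq k i; first by move: neqij; rewrite -sk eqki eqxx.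
have ltik : before b i k := before_neg neqki nltki.
have := eq_after k ltik ltk; rewrite sk => /perm_inj eqjk.
by rewrite -eqjk ltji in nltki.
Qed.

(** * Cycle minima *)

Definition cycle_min s i : bool := [forall j : 'I_N in porbit s i, (i <= j)%N].

Lemma cycle_min_agree s t i : (forall j, (i <= j)%N -> s j = t j) ->
  cycle_min s i -> cycle_min t i.
Proof.
move=> eq_st /forall_inP min_i; apply/forall_inP => _ /porbitP[n ->].
suff -> : (t ^+ n)%g i = (s ^+ n)%g i by apply/min_i/mem_porbit.
elim: n => [|n IHn]; first by rewrite !expg0.
by rewrite !expgSr !permM IHn eq_st //; apply/min_i/mem_porbit.
Qed.

(** Otherwise the [s]-preimage [k] of [t i] lies below [i], off its [s]-cycle. The [t]-orbit of [i]
    then follows the [s]-orbit of [k] back to [k], against minimality. *)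
Lemma cycle_min_closing s t i : (forall j, (i < j)%N -> s j = t j) ->
  cycle_min s i -> cycle_min t i -> s i = t i.
Proof.
move=> eq_st /forall_inP min_s /forall_inP min_t.
pose k := (s^-1)%g (t i); have sk : s k = t i by rewrite permKV.
have [eqki|neqki] := eqVneq k i; first by rewrite -sk eqki.
have ltki : (k < i)%N.
  rewrite ltn_neqAle neqki leqNgt; apply/negP => ltik.
  by move: neqki; rewrite -(inj_eq (@perm_inj _ t)) -eq_st // sk eqxx.
have nki : k \notin porbit s i by apply: contraTN ltki => /min_s; lia.
have itE n : (t ^+ n.+1)%g i = (s ^+ n.+1)%g k.
  elim: n => [|n IHn]; first by rewrite !expg1 sk.
  rewrite expgSr permM IHn [in RHS]expgSr permM eq_st // ltn_neqAle.
  rewrite -{2}IHn min_t ?mem_porbit // andbT; apply: contraNneq nki => eqi.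
  rewrite porbit_sym; apply/porbitP; exists n.+1.
  exact: val_inj.
have := min_t _ (mem_porbit t #[s]%g i).
have := itE #[s]%g.-1; rewrite prednK ?order_gt0 // expg_order perm1 => ->.
by rewrite leqNgt ltki.
Qed.

(* Going back from [i] as long as one stays above [i], one ends at the only
   image that closes the cycle of [i] without visiting smaller indices. *)
Lemma cycle_min_swap s i : (i < s i)%N -> (i < (s^-1)%g i)%N ->
  exists2 k0, k0 \in choices true s i &
    {in choices true s i, forall k, cycle_min (swap s i k) i = (k == k0)}.
Proof.
move=> lti ltiV; pose p n := ((s^-1) ^+ n)%g i.
have pS n : p n.+1 = (s^-1)%g (p n) by rewrite /p expgSr permM.
(* [p n.+1] is the first point of the backward orbit, after its start, not above [i]; it exists
   because the orbit returns to [i]. *)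
have [n len minn]: exists2 n, (p n.+1 <= i)%N & forall m, (m < n)%N -> (i < p m.+1)%N.
  have exn : exists n, (p n.+1 <= i)%N.
    by exists #[s^-1]%g.-1; rewrite prednK ?order_gt0 // /p expg_order perm1.
  case: (ex_minnP exn) => n len minn; exists n => // m ltmn.
  by rewrite ltnNge; apply: contraL ltmn => /minn; rewrite -leqNgt.
have n_gt0 : (0 < n)%N.
  by case: n len {minn} => //; rewrite pS /p expg0 perm1 leqNgt ltiV.
pose k0 := p n.+1.
have sk0 : s k0 = p n by rewrite /k0 pS permKV.
have Kk0 : k0 \in choices true s i.
  by rewrite inE /= -leqNgt len sk0 -(prednK n_gt0) minn // prednK.
have min0 : cycle_min (swap s i k0) i.
  apply/forall_inP => _ /porbitP[r ->].
  (* The new cycle jumps from [i] to [p n], then descends through the [p m] to [p 0], which is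
     [i]. *)
  suff [m lemn ->] : exists2 m, (m <= n)%N & ((swap s i k0) ^+ r)%g i = p m.
    case: m lemn => [|m] ltmn; first by rewrite /p expg0 perm1.
    exact/ltnW/minn.
  elim: r => [|r [m lemn IHr]]; first by exists 0; rewrite // /p !expg0.
  rewrite expgSr permM IHr swapE.
  case: m lemn {IHr} => [|m] ltmn.
    by exists n; rewrite // /p expg0 perm1 tpermL.
  exists m; first exact: ltnW.
  rewrite tpermD ?pS ?permKV //; rewrite -pS; apply/negP => /eqP eqp; have := minn m ltmn.
    by rewrite -eqp ltnn.
  by rewrite -eqp ltnNge len.
exists k0 => // k Kk; apply/idP/eqP => [mink|-> //].
have: swap s i k i = swap s i k0 i.
  apply: cycle_min_closing => // j ltij; rewrite !swapE.
  have [lek lek0] : (k <= i)%N /\ (k0 <= i)%N.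
    by move: Kk Kk0; rewrite !inE /= -!leqNgt => /andP[-> _] /andP[-> _].
  by rewrite !tpermD // -val_eqE /=; lia.
by rewrite !swapE !tpermL => /perm_inj.
Qed.

Lemma cyc_cycle_min s : cyc s = #|[set i : 'I_N | cycle_min s i]|.
Proof.
rewrite /cyc; have inj : {in [set i : 'I_N | cycle_min s i] &, injective (porbit s)}.
  move=> i j; rewrite !inE => /forall_inP min_i /forall_inP min_j eqij.
  have ji : j \in porbit s i by rewrite eqij porbit_id.
  have ij : i \in porbit s j by rewrite -eqij porbit_id.
  by apply/val_inj/eqP; rewrite eqn_leq min_i ?min_j.
rewrite -(card_in_imset inj); congr #|pred_of_set _|; apply/setP => A.
apply/imsetP/imsetP => [[i _ ->]|[i _ ->]]; last by exists i.
case: (arg_minnP (fun j : 'I_N => j : nat) (porbit_id s i)) => j ij min_j.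
have eqij : porbit s i = porbit s j by apply/eqP; rewrite eq_porbit_mem porbit_sym.
exists j => //; rewrite inE; apply/forall_inP => k; rewrite -eqij.
exact: min_j.
Qed.

Lemma cycle_min_fix s i : s i = i -> cycle_min s i.
Proof.
move=> si; apply/forall_inP => _ /porbitP[n ->].
by elim: n => [|n IHn]; rewrite ?expg0 ?perm1 // expgSr permM -{1}si permX_fix.
Qed.

Lemma cycle_min_valley s i : s i != i -> cycle_min s i ->
  (i < s i)%N && (i < (s^-1)%g i)%N.
Proof.
move=> nsi /forall_inP min_i.
have le1 : (i <= s i)%N by apply: min_i; have := mem_porbit s 1 i; rewrite expg1.
have le2 : (i <= (s^-1)%g i)%N.
  by apply: min_i; have := mem_porbit (s^-1)%g 1 i; rewrite expg1 porbitV.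
by move: nsi le1 le2; have := permV_fix s i; rewrite -!val_eqE /=; lia.
Qed.

(** * Summing over a class of permutations with equal step types *)

Definition agree (E : pred 'I_N) s t : Prop := forall j, E j -> s j = t j.

(* [Y] contains one representative of each restriction to [E] of an element of
   [X], so that a sum over [Y] is a sum over partial permutations. *)
Definition transversal (X : {set 'S_N}) (E : pred 'I_N) (Y : {set 'S_N}) : Prop :=
  [/\ Y \subset X, forall s, s \in X -> exists2 t, t \in Y & agree E s t
    & {in Y &, forall s t, agree E s t -> s = t}].

(** The swaps of a representative [s] by [k] in [K s] represent the extensions of its restriction to
    [i]. As [F] depends on [E] only, it factors out, and the sum of [w] is always [W]. *)
Lemma transversal_swap (R : comNzRingType) (X Y : {set 'S_N}) (E E' : pred 'I_N) i
    (K : 'S_N -> {set 'I_N}) (F w : 'S_N -> R) (W : R) :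
  ~~ E i -> (forall j, E' j = (j == i) || E j) ->
  {in X, forall s, {in K s, forall k, swap s i k \in X /\ ~~ E k}} ->
  {in X &, forall s t, agree E s t -> (s^-1)%g (t i) \in K s} ->
  {in X &, forall s t, agree E s t -> F s = F t} ->
  {in X, forall s, \sum_(k in K s) w (swap s i k) = W} ->
  transversal X E Y ->
  exists2 Y' : {set 'S_N}, transversal X E' Y' &
    \sum_(s in Y') F s * w s = W * \sum_(s in Y) F s.
Proof.
move=> nEi E'E swapX Kall F_E sum_w [YX Yex Yuniq].
have inX s : s \in Y -> s \in X by apply: (subsetP YX).
have swap_agree s k : s \in X -> k \in K s -> agree E (swap s i k) s.
  move=> Xs Kk j Ej; have [_ nEk] := swapX s Xs k Kk.
  by rewrite swapE tpermD //; [apply: contraNneq nEi | apply: contraNneq nEk] => ->.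
pose D := [set p : 'S_N * 'I_N | (p.1 \in Y) && (p.2 \in K p.1)].
pose f (p : 'S_N * 'I_N) := swap p.1 i p.2.
have injf : {in D &, forall p q, agree E' (f p) (f q) -> p = q}.
  move=> [s k] [t l]; rewrite !inE /= => /andP[Ys Kk] /andP[Yt Kl] eq_f.
  have est : s = t.
    apply: Yuniq => // j Ej; have := eq_f j; rewrite E'E Ej orbT => /(_ isT).
    by rewrite /f /= !swap_agree ?inX.
  rewrite -est in eq_f *; congr (_, _); have := eq_f i.
  by rewrite E'E eqxx => /(_ isT); rewrite /f /= !swapE !tpermL => /perm_inj.
exists (f @: D).
  split=> [|s Xs|_ _ /imsetP[p Dp ->] /imsetP[q Dq ->] /(injf _ _ Dp Dq) -> //].
    apply/subsetP => _ /imsetP[[s k] /[!inE] /andP[/inX Xs Kk] ->].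
    by have [] := swapX s Xs k Kk.
  have [t Yt eq_st] := Yex s Xs; have Xt := inX t Yt.
  have eq_ts : agree E t s by move=> j /eq_st.
  have Kk := Kall t s Xt Xs eq_ts; set k := (t^-1)%g (s i) in Kk.
  exists (swap t i k); first by apply/imsetP; exists (t, k); rewrite // inE Yt.
  move=> j; rewrite E'E; case: eqP => [-> _|_ /= Ej].
    by rewrite swapE tpermL permKV.
  by rewrite swap_agree // eq_st.
rewrite big_imset /=; last by move=> p q Dp Dq eq_f; apply: injf => // j _; rewrite eq_f.
rewrite (eq_bigl (fun p => (p.1 \in Y) && (p.2 \in K p.1))); last by move=> p; rewrite inE.
rewrite -(pair_big_dep (mem Y) (fun s => mem (K s))
  (fun s k => F (f (s, k)) * w (f (s, k)))) /= mulr_sumr.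
apply: eq_bigr => s Ys; have Xs := inX s Ys; rewrite -(sum_w s Xs) mulr_suml.
apply: eq_bigr => k Kk; rewrite mulrC; congr (_ * _).
by apply: F_E (swap_agree _ _ Xs Kk) => //; case: (swapX s Xs k Kk).
Qed.

(** * Local weights and their sums over the choices *)

Section LocalWeights.
Variables (R : comNzRingType) (x1 x2 y1 y2 u1 u2 v2 we wo ze zo lambda : R).
Local Notation step_wt := (step_wt x1 x2 y1 y2 u1 u2 v2 we wo ze zo lambda).

Definition local_wt s i : R :=
  match index_type s i with
  | None => lambda * (if odd_index i then (if is_rec s i then zo else wo)
                      else (if is_rec s i then ze else we))
  | Some (true, false) => (if cycle_min s i then lambda else 1) * y1
  | Some (true, true) => if brec true s i then y2 else v2
  | Some (false, true) => if brec false s i then x1 else u1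
  | Some (false, false) => if brec false s i then x2 else u2
  end.

Lemma sum_unique (T : finType) (A : {set T}) (P : pred T) a0 (a b : R) :
  a0 \in A -> {in A, forall c, P c = (c == a0)} ->
  \sum_(c in A) (if P c then a else b) = a + (#|A|%:R - 1) * b.
Proof.
move=> Aa0 PE; rewrite (bigD1 a0) //= PE // eqxx (cardsD1 a0) Aa0 natrD addrAC subrr add0r.
congr (_ + _); rewrite (eq_bigr (fun=> b)) => [|c /andP[Ac /negbTE nc]].
  by rewrite sumr_const mulr_natl; congr (_ *+ _); apply: eq_card => c; rewrite !inE andbC.
by rewrite PE // nc.
Qed.

Lemma sum_local_wt s i (b := (i < s i)%N) : s i != i ->
  \sum_(k in choices b s i) local_wt (swap s i k) i
  = step_wt (odd_index i) (height s i) (index_type s i).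
Proof.
move=> nsi; have lti : before b i (s i).
  by move: nsi; rewrite /b -val_eqE /=; case: ltnP => //=; lia.
have type_swap k : k \in choices b s i -> index_type (swap s i k) i = index_type s i.
  by move=> Kk; apply: (swap_same_type lti).
rewrite /local_wt (eq_bigr (fun k => match index_type s i with
  | None => lambda * (if odd_index i then (if is_rec (swap s i k) i then zo else wo)
                      else (if is_rec (swap s i k) i then ze else we))
  | Some (true, false) => (if cycle_min (swap s i k) i then lambda else 1) * y1
  | Some (true, true) => if brec true (swap s i k) i then y2 else v2
  | Some (false, true) => if brec false (swap s i k) i then x1 else u1
  | Some (false, false) => if brec false (swap s i k) i then x2 else u2
  end)); last by move=> k /type_swap ->.
have [k0 Kk0 uniq_k0] := brec_swap lti.
(* The choices of an index moved up are counted by the height after it, the weights use the height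
   before it. *)
have := height_next s i; rewrite /index_type (negbTE nsi) -/b.
have cardK := card_choices b s i.
case: (boolP b) (cardK) => [b_up|b_low] card_b; case: ltnP => leiV /= hS.
- rewrite b_up in Kk0 uniq_k0.
  by rewrite (sum_unique _ _ Kk0 uniq_k0) card_b hS.
- have ltiV : (i < (s^-1)%g i)%N.
    by move: leiV nsi; rewrite -permV_fix -val_eqE /=; lia.
  have [k1 Kk1 uniq_k1] := cycle_min_swap b_up ltiV.
  rewrite -mulr_suml (sum_unique _ _ Kk1 uniq_k1) card_b hS mulr1.
  by rewrite -natr1 addrK.
- rewrite (negbTE b_low) in Kk0 uniq_k0.
  by rewrite (sum_unique _ _ Kk0 uniq_k0) card_b.
- rewrite (negbTE b_low) in Kk0 uniq_k0.
  by rewrite (sum_unique _ _ Kk0 uniq_k0) card_b.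
Qed.

Lemma local_wt_fix s i : s i = i ->
  local_wt s i = step_wt (odd_index i) (height s i) (index_type s i).
Proof. by move=> si; rewrite /local_wt /index_type si eqxx fix_rec. Qed.
End LocalWeights.

Lemma same_type_sym s t : same_type s t -> same_type t s.
Proof. by move=> eq_st i. Qed.

Lemma same_type_trans s t r : same_type s t -> same_type t r -> same_type s r.
Proof. by move=> eq_st eq_tr i; rewrite eq_st. Qed.

Lemma same_type_fix s t i : same_type s t -> (s i == i) = (t i == i).
Proof. by move/(_ i); rewrite /index_type; do 2!case: ifP. Qed.

Lemma height_type s t m : same_type s t -> (m <= N)%N -> height s m = height t m.
Proof.
move=> eq_st lemN; rewrite !height_at_perm //; congr (height_at _ _).
exact: eq_map.
Qed.

Section TypeClass.
Variable s0 : 'S_N.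

Definition type_class : {set 'S_N} := [set s | [forall i, index_type s i == index_type s0 i]].

Lemma type_classP s : reflect (same_type s s0) (s \in type_class).
Proof. by rewrite inE; apply: (iffP forallP) => H i; apply/eqP/H. Qed.

Lemma type_class_same s t : s \in type_class -> t \in type_class -> same_type s t.
Proof.
by move=> /type_classP eq_s /type_classP eq_t i; rewrite eq_s eq_t.
Qed.

(* Images are chosen first for the indices moved down, from left to right,
   then for the indices moved up, from right to left. *)
Definition stage i : nat := if (i < s0 i)%N then (N + N - i.+1)%N else i.

Definition chosen m i : bool := (s0 i != i) && (stage i < m)%N.

Lemma stage_before b s i j : s \in type_class -> before b i (s i) -> before b j (s j) ->
  (stage j < stage i)%N = before b i j.
Proof.
move=> /type_classP /index_type_before[eq_out _] lti ltj.
have ltiN := ltn_ord i; have ltjN := ltn_ord j.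
have eq_up k : (k < s0 k)%N = (k < s k)%N by have /= := eq_out true k.
rewrite /stage !eq_up; move: lti ltj; clear eq_up eq_out.
case: b => /=; first by move=> -> ->; lia.
by move=> lti ltj; rewrite !ifF //; lia.
Qed.

Lemma before_chosen b s i j : s \in type_class -> before b i (s i) ->
  before b i j -> before b j (s j) -> chosen (stage i) j.
Proof.
move=> Xs lti ltij ltj; have /type_classP eq_s := Xs.
rewrite /chosen (stage_before Xs lti ltj) ltij andbT -(same_type_fix _ eq_s).
by apply: contraTneq ltj => ->; rewrite before_irr.
Qed.

Lemma stage_inj i j : s0 i != i -> s0 j != j -> stage i = stage j -> i = j.
Proof.
have := ltn_ord i; have := ltn_ord j.
rewrite /stage => ? ? _ _ eq_ij; apply/val_inj.
by move: eq_ij; do 2!case: ifP; rewrite /=; lia.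
Qed.

Section Weights.
Variables (R : comNzRingType) (x1 x2 y1 y2 u1 u2 v2 we wo ze zo lambda : R).
Local Notation step_wt := (step_wt x1 x2 y1 y2 u1 u2 v2 we wo ze zo lambda).
Local Notation local_wt := (local_wt x1 x2 y1 y2 u1 u2 v2 we wo ze zo lambda).

(** Record status is settled by [brec_revealed]. For an index moved up, all images from [i] onwards
    are known, as the indices moved down came first; this settles [cycle_min]. *)
Lemma local_wt_chosen s t i : s \in type_class -> t \in type_class -> s0 i != i ->
  agree (chosen (stage i).+1) s t -> local_wt s i = local_wt t i.
Proof.
move=> Xs Xt ni eq_st; have same_st := type_class_same Xs Xt.
have same_ts := same_type_sym same_st.
have /type_classP eq_s := Xs; have /type_classP eq_t := Xt.
have nsi : s i != i by rewrite (same_type_fix _ eq_s).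
have eqi : s i = t i by apply: eq_st; rewrite /chosen ni ltnSn.
pose b := (i < s i)%N.
have lti : before b i (s i).
  by move: nsi; rewrite /b -val_eqE /=; case: ltnP => //=; lia.
have lti' : before b i (t i) by rewrite -eqi.
have later j : before b i j -> before b j (s j) -> s j = t j.
  move=> ltij ltj; apply: eq_st.
  by have := before_chosen Xs lti ltij ltj; rewrite /chosen ltnS => /andP[-> /ltnW].
have later' j : before b i j -> before b j (t j) -> t j = s j.
  by move=> ltij ltj; rewrite later // (index_type_before same_st).1.
have eq_rec : brec b s i = brec b t i.
  by apply/idP/idP; apply: brec_revealed.
have eq_min : b -> cycle_min s i = cycle_min t i.
  move=> up; suff eq_ge j : (i <= j)%N -> s j = t j.
    by apply/idP/idP; apply: cycle_min_agree => j leij; rewrite eq_ge.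
  rewrite leq_eqVlt => /predU1P[/val_inj <- // | ltij].
  have [sj|nsj] := eqVneq (s j) j.
    by apply/eqP; rewrite sj eq_sym -(same_type_fix _ same_st) sj.
  apply: eq_st; rewrite /chosen -(same_type_fix _ eq_s) nsj /= /stage.
  have eq_up k : (k < s0 k)%N = (k < s k)%N by have /= := (index_type_before eq_s).1 true k.
  rewrite !eq_up -/b up.
  by have := ltn_ord i; have := ltn_ord j; case: ifP => _; lia.
rewrite /local_wt -same_st /index_type (negbTE nsi) -/b.
by case: (boolP b) eq_rec eq_min => [_ -> -> // | _ -> _].
Qed.

(** By induction on the stage, each index treated multiplies the sum over partial permutations by
    its step weight; fixed points are forced and contribute constant factors. *)
Lemma type_class_sum :
  \sum_(s in type_class) \prod_i local_wt s i
  = \prod_i step_wt (odd_index i) (height s0 i) (index_type s0 i).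
Proof.
pose W i := step_wt (odd_index i) (height s0 i) (index_type s0 i).
have stepE s i : s \in type_class ->
    step_wt (odd_index i) (height s i) (index_type s i) = W i.
  by move/type_classP=> eq_s; rewrite /W eq_s (height_type eq_s) // ltnW.
have elim m : exists2 Y, transversal type_class (chosen m) Y &
    \sum_(s in Y) \prod_(j | chosen m j) local_wt s j = \prod_(j | chosen m j) W j.
  elim: m => [|m [Y trY sumY]].
    have chosen0 : chosen 0 =1 xpred0 by move=> j; rewrite /chosen andbF.
    exists [set s0]; last by rewrite big_set1 !big_pred0.
    split=> [|s _|s t /set1P -> /set1P -> //].
    - by rewrite sub1set; apply/type_classP.
    - by exists s0; rewrite ?set11 // => j; rewrite chosen0.
  have [/existsP[i /andP[ni /eqP def_m]] | none] :=
      boolP [exists i, (s0 i != i) && (stage i == m)]; last first.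
    have eqE : chosen m.+1 =1 chosen m.
      move=> j; rewrite /chosen ltnS leq_eqVlt; case: eqVneq => //= nj.
      by move/existsPn/(_ j): none; rewrite nj /= => /negbTE ->.
    exists Y; last by rewrite (eq_bigl _ _ eqE) -sumY; apply: eq_bigr => s _; apply: eq_bigl.
    have [YX Yex Yuniq] := trY; split=> // [s /Yex[t Yt eq_st]|s t Ys Yt eq_st].
      by exists t => // j; rewrite eqE; apply: eq_st.
    by apply: Yuniq => // j; rewrite -eqE; apply: eq_st.
  have E'E j : chosen m.+1 j = (j == i) || chosen m j.
    rewrite /chosen ltnS leq_eqVlt; have [->|nji] /= := eqVneq j i.
      by rewrite ni def_m eqxx.
    have [//|nj] /= := eqVneq (s0 j) j; case: eqP => //= stj.
    by case/eqP: nji; apply: stage_inj; rewrite // stj def_m.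
  have nEi : ~~ chosen m i by rewrite /chosen def_m ltnn andbF.
  pose b := (i < s0 i)%N.
  have lti s : s \in type_class -> before b i (s i).
    move=> /type_classP/index_type_before[-> _]; move: ni.
    by rewrite /b -val_eqE /=; case: ltnP => //=; lia.
  have [|||| Y' trY' sumY'] := @transversal_swap R type_class Y (chosen m) (chosen m.+1) i
    (fun s => choices b s i) (fun s => \prod_(j | chosen m j) local_wt s j)
    (fun s => local_wt s i) (W i) nEi E'E _ _ _ _ trY.
  - move=> s Xs k Kk; split.
      apply/type_classP/(same_type_trans (swap_same_type (lti s Xs) Kk)).
      exact/type_classP.
    have ltk : before b k (s k).
      by move: Kk (lti s Xs); rewrite inE => /andP[]; case: (b) => /=; lia.
    move: Kk; rewrite inE => /andP[leki _].
    by rewrite /chosen -def_m (stage_before Xs (lti s Xs) ltk) (negbTE leki) andbF.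
  (* Were the [s]-preimage of [t i] after [i], it would be chosen already, so [t] would agree with
     [s] there and it would equal [i]. *)
  - move=> s t Xs Xt eq_st; have [_ eq_in] := index_type_before (type_class_same Xs Xt).
    rewrite inE permKV lti // andbT; apply/negP => ltik.
    have ltk : before b ((s^-1)%g (t i)) (t i) by rewrite eq_in permK lti.
    have chosen_k : chosen m ((s^-1)%g (t i)).
      by rewrite -def_m; apply: before_chosen (lti s Xs) ltik _; rewrite // permKV.
    have := eq_st _ chosen_k; rewrite permKV => /perm_inj eqik.
    by rewrite -eqik before_irr in ltik.
  - move=> s t Xs Xt eq_st; apply: eq_bigr => j /andP[nj ltjm].
    apply: local_wt_chosen => // k /andP[nk ltk]; apply: eq_st.
    by rewrite /chosen nk (leq_trans ltk).
  - move=> s Xs; have eq_s := type_classP _ Xs; rewrite -(stepE s i Xs).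
    have -> : b = (i < s i)%N by have /= := (index_type_before eq_s).1 true i.
    by apply: sum_local_wt; rewrite (same_type_fix _ eq_s).
  have prodE (G : 'I_N -> R) :
      \prod_(j | chosen m.+1 j) G j = G i * \prod_(j | chosen m j) G j.
    rewrite (bigD1 i) ?E'E ?eqxx //=; congr (_ * _); apply: eq_bigl => j.
    by rewrite E'E; case: eqVneq => [->|] /=; rewrite ?andbT ?(negbTE nEi).
  exists Y' => //; rewrite prodE -sumY -sumY'; apply: eq_bigr => s _.
  by rewrite prodE mulrC.
have [Y [YX Yex _] sumY] := elim (N + N)%N.
have chosenE : chosen (N + N) =1 (fun j => s0 j != j).
  move=> j; rewrite /chosen /stage; have := ltn_ord j.
  by case: ifP => _ ltj; rewrite [X in _ && X](_ : _ = true) ?andbT //; lia.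
(* Once every moved index is chosen, agreement is equality within the class. *)
have defY : Y = type_class.
  apply/eqP; rewrite eqEsubset YX; apply/subsetP => s Xs.
  have [t Yt eq_st] := Yex s Xs; have Xt := subsetP YX t Yt.
  suff -> : s = t by [].
  apply/permP => j; have [fixj|nj] := eqVneq (s0 j) j; last by apply: eq_st; rewrite chosenE.
  have fix_type r : r \in type_class -> r j = j.
    by move/type_classP=> eq_r; apply/eqP; rewrite (same_type_fix _ eq_r) fixj.
  by rewrite !fix_type.
rewrite (bigID (fun j => s0 j != j)) /= -/(W _).
rewrite -(eq_bigl _ _ chosenE) -sumY defY mulr_suml; apply: eq_bigr => s Xs.
rewrite (bigID (fun j => s0 j != j)) /=; congr (_ * _); first exact: eq_bigl.
apply: eq_bigr => j; rewrite negbK => fixj; rewrite -/(W j) -(stepE s j Xs).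
apply: local_wt_fix; apply/eqP; rewrite (same_type_fix (t := s0)) //.
exact/type_classP.
Qed.
End Weights.
End TypeClass.

(** * Existence of permutations with given step types *)

(* Reading the path from left to right, [O] is the set of indices moved up
   whose image has not been reached yet: [s] maps them temporarily to the
   indices that are images of indices not reached yet. *)
Lemma perm_of_path (o : bool) (l : seq step_type) : size l = N ->
  valid_path o 0 l -> exists s, forall i, index_type s i = nth None l i.
Proof.
move=> size_l valid_l.
pose out_ok (t : step_type) (j v : nat) :=
  if t is Some (u, _) then before u j v else v == j.
pose in_ok (t : step_type) (j v : nat) :=
  if t is Some (_, d) then before d v j else v == j.
pose is_up (t : step_type) := if t is Some (true, _) then true else false.
pose from_above (t : step_type) := if t is Some (_, false) then true else false.
(* The size of [O] is the current height. Arcs from [O] are provisional: only the promised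
   directions are recorded, while all other arcs are final. *)
suff build m : (m <= N)%N -> exists s (O : {set 'I_N}) (o' : bool),
    [/\ valid_path o' #|O| (drop m l),
        forall j, (m <= j)%N -> s j = j /\ j \notin O,
        forall j, (j < m)%N -> if j \in O then is_up (nth None l j)
                               else out_ok (nth None l j) j (s j)
      & forall j, (j < m)%N -> if (s^-1)%g j \in O then from_above (nth None l j)
                               else in_ok (nth None l j) j ((s^-1)%g j)].
  have [s [O [o' [valid_O _ out_s in_s]]]] := build N (leqnn N).
  move: valid_O; rewrite drop_oversize ?size_l // => /eqP/cards0_eq O0.
  exists s => i; have := out_s i (ltn_ord i); have := in_s i (ltn_ord i).
  rewrite O0 !inE /index_type -permV_fix -!val_eqE /=.
  have := permV_fix s i; rewrite -!val_eqE /=.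
  by case: (nth None l i) => [[[] []]|] /= *; last (by rewrite ifT //; lia);
    (rewrite ifF; last by lia); congr (Some (_, _)); lia.
elim: m => [_|m IHm ltmN].
  exists 1%g, set0, o; rewrite drop0 cards0; split=> // j _.
  by rewrite perm1 inE.
have [s [O [o' [valid_O fix_s out_s in_s]]]] := IHm (ltnW ltmN).
pose i := Ordinal ltmN; have [si nOi] := fix_s i (leqnn m).
have sVi : (s^-1)%g i = i by apply/eqP; rewrite permV_fix si.
have O_lt j : j \in O -> (j < m)%N.
  by move=> Oj; rewrite ltnNge; apply: contraL Oj => /fix_s[].
have neq_i j : (j < m)%N -> j != i by rewrite -val_eqE /= ltn_neqAle => /andP[].
have ltS j : (j < m.+1)%N -> j = i \/ (j < m)%N.
  by rewrite ltnS leq_eqVlt => /predU1P[eqj|]; [left; apply: val_inj | right].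
have nth_i : nth None l i = nth None l m by [].
move: valid_O; rewrite (drop_nth None) ?size_l //= -nth_i.
case def_t: (nth None l i) => [[u d]|]; last first.
  move=> valid_O; exists s, O, (~~ o'); split=> // [j /ltnW/fix_s //|j|j].
    by case/ltS=> [->|/out_s //]; rewrite (negbTE nOi) def_t /= si.
  by case/ltS=> [->|/in_s //]; rewrite sVi (negbTE nOi) def_t /=.
rewrite /step_ok => /andP[/andP[_ ok_t] valid_O].
(* A valley stays provisionally fixed, pending both as a source and as an image. *)
have [/andP[u1 /negbTE d0]|open_i] := boolP (u && ~~ d).
  exists s, (i |: O), (~~ o'); split=> [|j ltmj|j|j].
  - by rewrite cardsU1 nOi add1n; rewrite u1 d0 in valid_O.
  - have [sj nOj] := fix_s j (ltnW ltmj); rewrite !inE negb_or nOj andbT; split=> //.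
    by rewrite -val_eqE /=; lia.
  - case/ltS=> [->|ltjm]; first by rewrite !inE eqxx def_t u1.
    by rewrite !inE (negbTE (neq_i j ltjm)); apply: out_s.
  case/ltS=> [->|ltjm]; first by rewrite sVi !inE eqxx def_t d0.
  rewrite !inE -[X in X || _](inj_eq (@perm_inj _ s)) permKV si (negbTE (neq_i j ltjm)).
  exact: in_s.
have /card_gt0P[q Oq] : (0 < #|O|)%N by move: ok_t; rewrite (negbTE open_i).
have ltqm := O_lt q Oq; have nqi := neq_i q ltqm.
have lt_v : (s q < m)%N.
  rewrite ltnNge; apply/negP => lemv; have [/perm_inj eq_q _] := fix_s _ lemv.
  by rewrite eq_q leqNgt ltqm in lemv.
have nvi := neq_i _ lt_v.
(* After the swap [q] maps to [i], for good if [d] holds, and [i] maps to the old [s q], for good if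
   [u] fails. *)
pose O' := [set j | if j == i then u else if j == q then ~~ d else j \in O].
have cardO' : #|O'| = next_height #|O| (Some (u, d)).
  have defO' : O' = (if u then [set i] else set0) :|: (if d then O :\ q else O).
    apply/setP => j; rewrite !inE; case: eqVneq => [->|nji].
      by case: (u) (d) => [] []; rewrite !inE ?eqxx ?(negbTE nOi) ?andbF.
    by case: eqVneq => [->|nj]; case: (u) (d) => [] [];
      rewrite !inE ?eqxx ?Oq ?(negbTE nqi) ?(negbTE nji) ?nj.
  have cardq : #|O| = (#|O :\ q|).+1 by rewrite (cardsD1 q) Oq.
  rewrite defO'; case: (u) (d) open_i => [] [] //= _; rewrite ?set0U // ?cardsU1.
    by rewrite !inE negb_and nOi orbT cardq.
  by rewrite cardq.
have swapVi : ((swap s q i)^-1)%g i = q by rewrite swapVE sVi tpermR.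
have swapVv : ((swap s q i)^-1)%g (s q) = i by rewrite swapVE permK tpermL.
exists (swap s q i), O', (~~ o'); split=> [|j ltmj|j|j].
- by rewrite cardO'.
- have [sj nOj] := fix_s j (ltnW ltmj).
  have [nji njq] : j != i /\ j != q by rewrite -!val_eqE /=; lia.
  by rewrite swapE tpermD 1?eq_sym // !inE (negbTE nji) (negbTE njq).
- case/ltS=> [->|ltjm].
    rewrite !inE eqxx def_t swapE tpermR.
    by case: (u) => //=; rewrite lt_v.
  rewrite !inE (negbTE (neq_i j ltjm)); case: eqVneq => [->|njq].
    have := out_s q ltqm; rewrite Oq swapE tpermL si.
    by case: (d) (nth None l q) => [] [[[] ?]|] //=.
  by rewrite swapE tpermD 1?eq_sym ?neq_i //; apply: out_s.
case/ltS=> [->|ltjm].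
  rewrite swapVi !inE (negbTE nqi) eqxx def_t.
  by case: (d) => //=; rewrite ltqm.
have [->|njv] := eqVneq j (s q).
  have := in_s (s q) lt_v; rewrite permK Oq swapVv !inE eqxx.
  by case: (u) (nth None l (s q)) => [] [[? []]|] //=; rewrite lt_v.
have nVq : (s^-1)%g j != q by rewrite -(inj_eq (@perm_inj _ s)) permKV.
have nVi : (s^-1)%g j != i by rewrite -(inj_eq (@perm_inj _ s)) permKV si neq_i.
rewrite swapVE tpermD 1?eq_sym // !inE (negbTE nVq) (negbTE nVi).
exact: in_s.
Qed.
End PermTypes.

(** * From permutations to paths *)

Definition type_tuple N (s : 'S_N) : N.-tuple step_type := [tuple index_type s i | i < N].

Lemma type_tupleE N (s : 'S_N) : type_tuple s = [seq index_type s i | i <- enum 'I_N] :> seq _.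
Proof. by []. Qed.

Lemma nth_type_tuple N (s : 'S_N) (i : 'I_N) : nth None (type_tuple s) i = index_type s i.
Proof. by rewrite -tnth_nth tnth_mktuple. Qed.

Lemma type_tuple_eq N (s t : 'S_N) :
  (type_tuple s == type_tuple t) = (s \in type_class t).
Proof.
apply/eqP/type_classP => [eq_st i|eq_st]; first by rewrite -!nth_type_tuple eq_st.
by apply: eq_from_tnth => i; rewrite !tnth_mktuple.
Qed.

Lemma Dindex_type N (s : 'S_N) :
  Dperm s = [forall i, if index_type s i is Some (u, _) then u == odd_index i else true].
Proof.
apply: eq_forallb => i; rewrite /even_index /odd_index /index_type -val_eqE /=.
by case: (odd i); case: ltngtP.
Qed.

Lemma valid_path_ok o h l i : valid_path o h l -> (i < size l)%N ->
  if nth None l i is Some (u, _) then u == o (+) odd i else true.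
Proof.
elim: l o h i => [|t l IHl] o h [|i] //= /andP[ok_t valid_l] lti.
  by case: t ok_t {valid_l} => [[u d]|] //= /andP[]; rewrite addbF.
by have := IHl _ _ i valid_l lti; rewrite addNb addbN.
Qed.

Lemma valid_path_perm N (s : 'S_N) : Dperm s -> valid_path true 0 (type_tuple s).
Proof.
rewrite Dindex_type => /forallP Ds.
(* Suffixes are checked from the right end, where the height is 0. *)
suff valid_s m : (m <= N)%N ->
    valid_path (odd (N - m).+1) (height s (N - m)) (drop (N - m) (type_tuple s)).
  by have := valid_s N (leqnn N); rewrite subnn height0 drop0.
elim: m => [_|m IHm ltmN].
  by rewrite subn0 drop_oversize ?size_tuple //= heightN.
have ltN : (N - m.+1 < N)%N by lia.
pose i := Ordinal ltN; have defS : (N - m = i.+1)%N by rewrite /=; lia.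
rewrite (drop_nth None) ?size_tuple // -[(N - m.+1)%N]/(i : nat) nth_type_tuple.
move: (IHm (ltnW ltmN)); rewrite defS height_next /= => ->; rewrite andbT.
rewrite /step_ok; have := Ds i; rewrite /index_type; case: eqVneq => // nsi ->.
rewrite /=; case: ltnP => /= [_|lesi].
  case: ltnP => //= ltV; rewrite card_gt0; apply/set0Pn; exists ((s^-1)%g i).
  by rewrite inE permKV ltV leqnn.
rewrite -height_sym card_gt0; apply/set0Pn; exists i; rewrite inE leqnn andbT.
by rewrite ltn_neqAle lesi andbT.
Qed.

Section PermWeights.
Variables (R : comNzRingType) (x1 x2 y1 y2 u1 u2 v2 we wo ze zo lambda : R).
Local Notation step_wt := (step_wt x1 x2 y1 y2 u1 u2 v2 we wo ze zo lambda).
Local Notation path_wt := (path_wt x1 x2 y1 y2 u1 u2 v2 we wo ze zo lambda).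
Local Notation local_wt := (local_wt x1 x2 y1 y2 u1 u2 v2 we wo ze zo lambda).

Lemma exp_card (T : finType) (A : {set T}) (x : R) :
  x ^+ #|A| = \prod_a (if a \in A then x else 1).
Proof. by rewrite -prodr_const big_mkcond. Qed.

(** All exponents are cardinals of sets of indices, cycles being counted by their minima, so the
    factors are compared index by index. *)
Lemma statistics_local_wt N (s : 'S_N) : Dperm s ->
  x1 ^+ eareccpeak s * x2 ^+ eareccdfall s * y1 ^+ ereccval s * y2 ^+ ereccdrise s *
  u1 ^+ nrcpeak s * u2 ^+ nrcdfall s * y1 ^+ nrcval s * v2 ^+ nrcdrise s *
  we ^+ evennrfix s * wo ^+ oddnrfix s * ze ^+ evenrar s * zo ^+ oddrar s *
  lambda ^+ cyc s = \prod_i local_wt s i.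
Proof.
move=> Ds; rewrite cyc_cycle_min !exp_card -!big_split /=; apply: eq_bigr => i _.
rewrite !inE /cpeak /cval /cdrise /cdfall /fixpt /is_erec /is_earec /is_rar /is_nrar.
rewrite /local_wt /index_type /even_index -/(odd_index i).
have [si|nsi] := eqVneq (s i) i.
  have /eqP -> : (s^-1)%g i == i by rewrite permV_fix si.
  rewrite cycle_min_fix // fix_rec // fix_arec // si ltnn /=.
  by case: (odd_index i); case: (_ == 0) => /=; ring.
have nVi : (s^-1)%g i != i by rewrite permV_fix.
have mini := @cycle_min_valley _ s i nsi.
rewrite -[brec true s i]/(is_rec s i) -[brec false s i]/(is_arec s i).
case: (ltngtP i (s i)) => [lti|lti|/val_inj eqi]; last by rewrite -eqi eqxx in nsi.
  rewrite exc_not_arec // !andbF !andbT /=.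
  case: (ltngtP i ((s^-1)%g i)) => [ltV|ltV|/val_inj eqi]; last by rewrite -eqi eqxx in nVi.
    by case: (is_rec s i); case: (cycle_min s i) => /=; ring.
  have -> : cycle_min s i = false by apply: contraTF ltV => /mini/andP[_]; lia.
  by case: (is_rec s i) => /=; ring.
have -> : cycle_min s i = false by apply: contraTF lti => /mini/andP[]; lia.
rewrite aexc_not_rec // !andbF !andbT /=.
case: (ltngtP i ((s^-1)%g i)) => [ltV|ltV|/val_inj eqi]; last by rewrite -eqi eqxx in nVi.
  by case: (is_arec s i) => /=; ring.
by case: (is_arec s i) => /=; ring.
Qed.

(** If [l] is realised, the D-permutations concerned form a whole type class; if not, [perm_of_path]
    shows that [l] is no valid path, and both sides vanish. *)
Lemma sum_type_tuple N (l : N.-tuple step_type) :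
  \sum_(s : 'S_N | Dperm s && (type_tuple s == l)) \prod_i local_wt s i = path_wt true 0 l.
Proof.
have [s0 /andP[Ds0 /eqP <-]|none] := pickP (fun s : 'S_N => Dperm s && (type_tuple s == l)).
  rewrite path_wtE valid_path_perm // (eq_bigl (fun s => s \in type_class s0)); last first.
    move=> s; rewrite type_tuple_eq andbC; case: (boolP (s \in _)) => //= Xs.
    rewrite -Ds0 !Dindex_type; apply: eq_forallb => i.
    by have /type_classP -> := Xs.
  rewrite type_class_sum.
  rewrite -(big_mkord xpredT (fun i => step_wt (true (+) odd i)
    (height_at (type_tuple s0) i) (nth None (type_tuple s0) i))) size_tuple big_mkord.
  apply: eq_bigr => i _; rewrite nth_type_tuple type_tupleE -height_at_perm //.
  exact/ltnW.
rewrite big_pred0 // path_wtE; case: (boolP (valid_path _ _ _)) => // valid_l.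
have [s types] := perm_of_path (size_tuple l) valid_l.
have := none s; rewrite Dindex_type => /negbT/negP[]; apply/andP; split.
  apply/forallP => i; rewrite types.
  by have := valid_path_ok valid_l (i := i); rewrite size_tuple; apply.
by apply/eqP/eq_from_tnth => i; rewrite tnth_mktuple types (tnth_nth None).
Qed.

Lemma Phat_path_sum n :
  Phat x1 x2 y1 y2 u1 u2 y1 v2 we wo ze zo lambda n
  = path_sum x1 x2 y1 y2 u1 u2 v2 we wo ze zo lambda n.*2 true 0.
Proof.
rewrite -mul2n /Phat /path_sum (partition_big (@type_tuple _) xpredT) //=.
apply: eq_bigr => l _; rewrite -sum_type_tuple.
by apply: eq_bigr => s /andP[Ds _]; apply: statistics_local_wt.
Qed.
End PermWeights.

Theorem theorem4p1 (R : comNzRingType)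
    (x1 x2 y1 y2 u1 u2 v2 we wo ze zo lambda : R)
    (alpha delta : nat -> R)
    (alpha_odd : forall k : nat, (1 <= k)%N ->
       alpha (2 * k - 1)%N
       = (lambda + k%:R - 1) * (x1 + (k%:R - 1) * u1) * y1)
    (alpha_even : forall k : nat, (1 <= k)%N ->
       alpha (2 * k)%N
       = (x2 + (k%:R - 1) * u2 + lambda * we)
         * (y2 + (k%:R - 1) * v2 + lambda * wo))
    (delta_1 : delta 1%N = lambda ^+ 2 * ze * zo)
    (delta_ge2 : forall n : nat, (2 <= n)%N -> delta n = 0) :
  is_Tfraction
    (Phat x1 x2 y1 y2 u1 u2 y1 v2 we wo ze zo lambda) delta alpha.
Proof.
move=> m; have [M cvgM] := path_sum_Tfraction alpha_odd alpha_even delta_1 delta_ge2 m.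
by exists M => n leMn; rewrite Phat_path_sum; apply: cvgM.
Qed.
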